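(* Let $\Omega=\{\omega_1,\dots,\omega_n\}$ be a finite set of states and let $\mathcal{D}=\{(p^i,x^i)\}_{i=1}^k$ be a finite dataset with $p^i,x^i\in\mathbb{R}^n_+$ and $p^i\gg\mathbf{0}$ for all $i\le k$. Suppose that $\mathcal{D}$ is SEU-rationalizable by a strictly concave, increasing utility function $w:\mathbb{R}\to\mathbb{R}$ and a full-support probability measure $\pi$ on $\Omega$, and that each $x^i$ is a non-diversified demand. Then, for every scalable family $\mathcal{U}^*$ of increasing, convex and continuous functions from $\mathbb{R}_+$ to $\mathbb{R}$, there is $u\in\mathcal{U}^*$ such that $u$ is an SEU rationalization of $\mathcal{D}$ under $\pi$.
   Context: Vectors in $\mathbb{R}^n$ are indexed by states $\omega\in\Omega$; $p^i$ is a price vector and $x^i$ the demand at those prices. $x\gg y$ means $x_\omega>y_\omega$ for all $\omega\in\Omega$. The measure $\pi$ has full support if $\pi(\omega)>0$ for all $\omega\in\Omega$. Non-diversified demand: $x^i$ is a non-diversified demand if there is $\omega\in\Omega$ with $x^i_\omega>0$ and $x^i_{\omega'}=0$ for all $\omega'\neq\omega$. SEU rationalization: a real-valued function $u$ defined on (at least) $\mathbb{R}_+$ is an SEU rationalization of $\mathcal{D}$ under $\pi$ (equivalently, $\mathcal{D}$ is SEU-rationalizable by $u$ and $\pi$) if for every $i\le k$, $$\sum_{\omega\in\Omega}\pi(\omega)u(x^i_\omega)\ \ge\ \sum_{\omega\in\Omega}\pi(\omega)u(x_\omega)\quad\text{for all }x\in\mathbb{R}^n_+\text{ with }p^i\cdot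 x\le p^i\cdot x^i.$$ Subgradient: for $v:\mathbb{R}_+\to\mathbb{R}$, a subgradient of $v$ at $\overline{x}\in\mathbb{R}_+$ is a real number $y$ with $v(x)\ge v(\overline{x})+y(x-\overline{x})$ for all $x\in\mathbb{R}_+$. Scalable (convex case): a class $\mathcal{U}^*$ of continuous, increasing and convex functions from $\mathbb{R}_+$ to $\mathbb{R}$ is scalable if (1) there is $v\in\mathcal{U}^*$ with a (strictly) positive subgradient at $0$; and (2) for all $\alpha\in(0,1]$ and all $v\in\mathcal{U}^*$, the function $v_\alpha$ defined by $v_\alpha(x):=v(\alpha x)$ for $x\in\mathbb{R}_+$ belongs to $\mathcal{U}^*$. *)

(* Defs.v *)
From mathcomp Require Import all_boot all_order all_algebra.
From mathcomp Require Import all_classical all_reals.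
From mathcomp Require Import interval_inference topology normedtype convex.

Set Implicit Arguments.
Unset Strict Implicit.
Unset Printing Implicit Defensive.

Import Order.TTheory GRing.Theory Num.Theory.
Import numFieldNormedType.Exports.

Local Open Scope classical_set_scope.
Local Open Scope ring_scope.

(* A function from R_+ to R is represented by a total function R -> R whose
   values at negative arguments are irrelevant: rationalization and the
   conditions on utility classes only involve arguments in [0, +oo[.
   "Increasing" is read weakly there, which is the more general reading; for a
   strictly concave function on all of R the two readings coincide. *)

Section StatesAndData.
Variables (R : realType) (Omega : finType).

Definition probability_vector (pi : Omega -> R) : Prop :=
  (forall o, 0 <= pi o) /\ \sum_o pi o = 1.

Definition full_support (pi : Omega -> R) : Prop := forall o, 0 < pi o.

Definition dot (p x : Omega -> R) : R := \sum_o p o * x o.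

Definition dataset (k : nat) (p x : 'I_k -> Omega -> R) : Prop :=
  forall i, (forall o, 0 < p i o) /\ (forall o, 0 <= x i o).

Definition non_diversified (x : Omega -> R) : Prop :=
  exists o, 0 < x o /\ forall o', o' != o -> x o' = 0.

Definition SEU (pi : Omega -> R) (u : R -> R) (x : Omega -> R) : R :=
  \sum_o pi o * u (x o).

Definition SEU_rationalization (k : nat) (p x : 'I_k -> Omega -> R)
    (u : R -> R) (pi : Omega -> R) : Prop :=
  forall (i : 'I_k) (z : Omega -> R),
    (forall o, 0 <= z o) -> dot (p i) z <= dot (p i) (x i) ->
    SEU pi u z <= SEU pi u (x i).

End StatesAndData.

Section UtilityClasses.
Variable R : realType.

Definition strictly_concave (w : R -> R) : Prop :=
  forall (x y t : R), x != y -> 0 < t -> t < 1 ->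
    t * w x + (1 - t) * w y < w (t * x + (1 - t) * y).

Definition subgradient (v : R -> R) (xbar y : R) : Prop :=
  forall x, 0 <= x -> v xbar + y * (x - xbar) <= v x.

Definition increasing_convex_continuous (v : R -> R) : Prop :=
  [/\ {in `[0, +oo[ &, {homo v : x y / x <= y}},
      convex_function (`[0, +oo[ : set R^o) v
    & {within `[0, +oo[, continuous v}].

(* Since only values on R_+ are meaningful, "v_alpha belongs to U" says that
   some member of U agrees with x |-> v (alpha * x) on R_+. *)
Definition scalable_class (U : set (R -> R)) : Prop :=
  [/\ (forall v, U v -> increasing_convex_continuous v),
      (exists2 v, U v & exists2 y, 0 < y & subgradient v 0 y)
    & (forall (alpha : R) (v : R -> R), 0 < alpha -> alpha <= 1 -> U v ->
        exists2 v_alpha, U v_alpha &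
          forall x, 0 <= x -> v_alpha x = v (alpha * x))].

End UtilityClasses.

(* Main.v *)
(** At a corner demand in state o, moving part of the budget to another state
    o' cannot help the strictly concave w; since the marginal utility of w is
    strictly smaller at the demanded quantity than at 0, this forces the strict
    inequality pi o' / p o' < pi o / p o. A convex v with a positive subgradient
    at 0 has a positive finite right derivative d there, so x |-> v (alpha * x)
    is, for small alpha, as close as desired in relative terms to being linear
    on the (bounded) budget sets. Up to this relative error, spending in state o
    yields pi o / p o per unit of money, so o is the best state to invest in;
    convexity then favours concentrating the whole budget there. *)
Require Import Defs.
From mathcomp Require Import all_boot all_order all_algebra.
From mathcomp Require Import all_classical all_reals.
From mathcomp Require Import interval_inference topology normedtype convex.
From mathcomp Require Import ring lra.

Set Implicit Arguments.
Unset Strict Implicit.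
Unset Printing Implicit Defensive.

Import Order.TTheory GRing.Theory Num.Theory.

Local Open Scope classical_set_scope.
Local Open Scope ring_scope.

Lemma uniform_strict_gap (R : realType) (I : finType) (P : pred I)
    (a b : I -> R) :
  (forall i, P i -> 0 < a i) -> (forall i, P i -> a i < b i) ->
  exists2 e, 0 < e & forall i, P i -> (1 + e) * a i <= b i.
Proof.
move=> a_gt0 ltab.
(* The default value 1 keeps the minimum positive even when no index satisfies [P]. *)
exists (\big[Order.min/1]_(i | P i) ((b i - a i) / a i)).
  apply: lt_bigmin => // i Pi.
  by rewrite divr_gt0 ?a_gt0// subr_gt0 ltab.
move=> i Pi; rewrite mulrDl mul1r -lerBrDl -ler_pdivlMr ?a_gt0//.
exact: bigmin_le_cond.
Qed.

Lemma convex_chord (R : realType) (v : R -> R) :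
  convex_function (`[0, +oo[ : set R^o) v ->
  forall s t, 0 <= s -> s <= t -> 0 < t -> v s - v 0 <= s / t * (v t - v 0).
Proof.
move=> cv s t s0 st t0.
have q0 : 0 <= s / t by rewrite divr_ge0// ltW.
have q1 : s / t <= 1 by rewrite ler_pdivrMr// mul1r.
have tD : (t : R^o) \in (`[0, +oo[%classic : set R^o).
  by rewrite inE/= in_itv/= andbT ltW.
have zD : (0 : R^o) \in (`[0, +oo[%classic : set R^o).
  by rewrite inE/= in_itv/= andbT.
have := cv (Itv01 q0 q1) t 0 tD zD.
rewrite [leRHS]convRE [conv _ _ _]convRE /= mulr0 addr0 mulfVK ?gt_eqF//.
rewrite /unstable.onem; lra.
Qed.

(** The constant [d] is the infimum of the chord slopes from 0; the subgradient bounds these slopes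
    below by [y], so [d] is positive. Some [t0] has slope below [(1 + e) * d], and chord slopes from
    0 only decrease as [t] shrinks. *)
Lemma convex_near_linear (R : realType) (v : R -> R) (y e : R) :
  convex_function (`[0, +oo[ : set R^o) v ->
  0 < y -> subgradient v 0 y -> 0 < e ->
  exists d t0, [/\ 0 < d, 0 < t0 & forall t, 0 <= t -> t <= t0 ->
    d * t <= v t - v 0 <= (1 + e) * d * t].
Proof.
move=> cv y0 sub e0.
pose slope t := (v t - v 0) / t.
pose S := [set slope t | t in [set t | 0 < t]].
have ylb : lbound S y.
  move=> _ [t /= t0 <-]; rewrite /slope ler_pdivlMr//.
  by have := sub t (ltW t0); rewrite subr0; lra.
have Sne : S !=set0 by exists (slope 1); exists 1 => //=.
have hS : has_inf S by split => //; exists y.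
have d0 : 0 < inf S by apply: lt_le_trans (lb_le_inf Sne ylb).
have [_ [t0 /= t0_gt0 <-] lt_e] := inf_adherent (mulr_gt0 e0 d0) hS.
exists (inf S), t0; split=> // t t_ge0 tt0.
have [->|tN0] := eqVneq t 0; first by rewrite subrr !mulr0 lexx.
have t_gt0 : 0 < t by rewrite lt0r tN0.
rewrite -ler_pdivlMr//; apply/andP; split.
  by apply: ge_inf; [exists y|exists t].
apply: le_trans (convex_chord cv t_ge0 tt0 t0_gt0) _.
rewrite mulrAC -mulrA [leRHS]mulrC ler_pM2l//.
by apply/ltW; apply: lt_le_trans lt_e _; rewrite mulrDl mul1r.
Qed.

Section Corner.
Variables (R : realType) (Omega : finType) (pi p x : Omega -> R) (o : Omega).
Hypothesis x_off : forall o', o' != o -> x o' = 0.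

Lemma dot_corner : dot p x = p o * x o.
Proof.
rewrite /dot (bigD1 o)//= big1 ?addr0// => o' o'o.
by rewrite x_off// mulr0.
Qed.

Lemma corner_price_ratio (w : R -> R) (o' : Omega) :
  (forall o, 0 < p o) -> (forall o, 0 < pi o) -> 0 < x o ->
  strictly_concave w -> {homo w : s t / s <= t} ->
  (forall z, (forall o, 0 <= z o) -> dot p z <= dot p x ->
     SEU pi w z <= SEU pi w x) ->
  o' != o -> pi o' * p o < pi o * p o'.
Proof.
move=> p0 pi0 xo0 wc wi opt o'o.
have po0 := p0 o; have po'0 := p0 o'.
have P0 : 0 < p o + p o' by rewrite addr_gt0.
pose q := p o / (p o + p o').
have q0 : 0 < q by rewrite divr_gt0.
have q1E : 1 - q = p o' / (p o + p o') by rewrite /q; field; rewrite gt_eqF.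
have q1 : q < 1 by rewrite -subr_gt0 q1E divr_gt0.
(* [a] is chosen so that holding [a] in both states costs exactly [p o * x o]. *)
pose a := q * x o.
have a0 : 0 < a by rewrite mulr_gt0.
pose z s := if (s == o) || (s == o') then a else 0.
have zo : z o = a by rewrite /z eqxx.
have zo' : z o' = a by rewrite /z eqxx orbT.
have zN s : s != o -> s != o' -> z s = 0.
  by rewrite /z => /negbTE -> /negbTE ->.
have budget : dot p z <= dot p x.
  rewrite dot_corner /dot (bigD1 o)//= (bigD1 o')//= big1 ?addr0; last first.
    by move=> s /andP[so so']; rewrite zN// mulr0.
  rewrite zo zo' /a /q le_eqVlt; apply/orP; left; apply/eqP.
  by field; rewrite gt_eqF.
have z_ge0 s : 0 <= z s by rewrite /z; case: ifP => // _; exact: ltW.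
have zE : SEU pi w z = pi o * w a + (pi o' * w a +
    \sum_(s | (s != o) && (s != o')) pi s * w 0).
  rewrite /SEU (bigD1 o)//= (bigD1 o')//= zo zo'; congr (_ + (_ + _)).
  by apply: eq_bigr => s /andP[so so']; rewrite zN.
have xE : SEU pi w x = pi o * w (x o) + (pi o' * w 0 +
    \sum_(s | (s != o) && (s != o')) pi s * w 0).
  rewrite /SEU (bigD1 o)//= (bigD1 o')//= (x_off o'o); congr (_ + (_ + _)).
  by apply: eq_bigr => s /andP[so so']; rewrite x_off.
have := opt z z_ge0 budget; rewrite zE xE => le_zx.
have gain : pi o' * (w a - w 0) <= pi o * (w (x o) - w a) by lra.
have D0 : 0 <= w (x o) - w a.
  by rewrite subr_ge0 wi// /a ler_piMl// ltW.
(* Strict concavity at [a], a point between 0 and [x o], makes the weighted gain from 0 to [a]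
   exceed that from [a] to [x o]; this is the source of strictness. *)
have := wc (x o) 0 q (lt0r_neq0 xo0) q0 q1; rewrite mulr0 addr0 -/a => cvx.
have lt_q : pi o' * q < pi o * (1 - q).
  have Q0 : 0 < 1 - q by rewrite subr_gt0.
  (* Otherwise [h1], [h2] and [h3] chain into a strict cycle starting and ending at
     [pi o' * q * (w (x o) - w a)]. *)
  have [//|le_q] := ltP (pi o' * q) (pi o * (1 - q)).
  have h1 : pi o' * (q * (w (x o) - w a)) < pi o' * ((1 - q) * (w a - w 0)).
    by rewrite ltr_pM2l//; lra.
  have h2 := ler_wpM2l (ltW Q0) gain.
  have h3 := ler_wpM2r D0 le_q.
  lra.
by move: lt_q; rewrite q1E /q !mulrA ltr_pM2r// invr_gt0.
Qed.

Lemma corner_SEU_max (u : R -> R) (d e T : R) :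
  (forall s, 0 < p s) -> (forall s, 0 < pi s) -> 0 < x o ->
  convex_function (`[0, +oo[ : set R^o) u ->
  0 < d -> (forall t, 0 <= t -> t <= T ->
    d * t <= u t - u 0 <= (1 + e) * d * t) ->
  (forall s, dot p x / p s <= T) ->
  (forall s, s != o -> (1 + e) * (pi s * p o) <= pi o * p s) ->
  forall z, (forall s, 0 <= z s) -> dot p z <= dot p x ->
    SEU pi u z <= SEU pi u x.
Proof.
move=> p0 pi0 xo0 cu d0 lin leT ratio z z0 budget.
have pz s : p s * z s <= dot p x.
  apply: le_trans budget; rewrite /dot (bigD1 s)//= lerDl sumr_ge0// => i _.
  by rewrite mulr_ge0// ltW.
have zT s : z s <= T.
  by apply: le_trans (leT s); rewrite ler_pdivlMr// mulrC.
have xoE : dot p x / p o = x o by rewrite dot_corner mulrC mulKf ?gt_eqF.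
have xoT : x o <= T by rewrite -xoE.
have m0 : 0 < dot p x by rewrite dot_corner mulr_gt0.
have /andP[gx _] := lin _ (ltW xo0) xoT.
have gx0 : 0 <= u (x o) - u 0.
  by apply: le_trans gx; rewrite mulr_ge0// ltW.
(* The share [p s * z s / dot p x] of wealth spent on state [s] yields at most
   that share of what is gained by spending all the wealth on [o]. *)
have share s : pi s * (u (z s) - u 0) <=
    p s * z s * (pi o * (u (x o) - u 0) / dot p x).
  (* In state [o] convexity alone suffices. In any other state the factor [1 + e] lost to
     near-linearity is absorbed by [ratio]. *)
  have [->|so] := eqVneq s o.
    have zox : z o <= x o by rewrite -(ler_pM2l (p0 o)) -dot_corner.
    have := ler_wpM2l (ltW (pi0 o)) (convex_chord cu (z0 o) zox xo0).
    rewrite dot_corner; congr (_ <= _); field.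
    by rewrite !gt_eqF.
  have /andP[_ gz] := lin _ (z0 s) (zT s).
  apply: le_trans (ler_wpM2l (ltW (pi0 s)) gz) _.
  have lin_share : p s * z s * (pi o * (d * x o) / dot p x) <=
      p s * z s * (pi o * (u (x o) - u 0) / dot p x).
    apply: ler_wpM2l; first by rewrite mulr_ge0// ltW.
    by rewrite ler_pM2r ?invr_gt0// ler_pM2l.
  apply: le_trans lin_share.
  have -> : p s * z s * (pi o * (d * x o) / dot p x) =
      d * z s / p o * (pi o * p s).
    by rewrite dot_corner; field; rewrite !gt_eqF.
  have -> : pi s * ((1 + e) * d * z s) =
      d * z s / p o * ((1 + e) * (pi s * p o)).
    by field; rewrite gt_eqF.
  apply: ler_wpM2l (ratio s so).
  by rewrite divr_ge0 ?mulr_ge0// ltW.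
(* Measuring utility from [u 0] makes every state but [o] contribute nothing at [x]. *)
have split_SEU f :
    SEU pi u f = \sum_s pi s * (u (f s) - u 0) + \sum_s pi s * u 0.
  by rewrite -big_split/=; apply: eq_bigr => s _; rewrite -mulrDr subrK.
rewrite !split_SEU lerD2r; apply: le_trans (ler_sum _ (fun s _ => share s)) _.
rewrite -mulr_suml [leRHS](bigD1 o)//= [X in _ <= _ + X]big1 ?addr0; last first.
  by move=> s so; rewrite x_off// subrr mulr0.
rewrite mulrA ler_pdivrMr// mulrC; apply: ler_wpM2l budget.
by rewrite mulr_ge0// ltW.
Qed.

End Corner.

Theorem proposition2 (R : realType) (Omega : finType)
  (k : nat) (p x : 'I_k -> Omega -> R)
  (hD : dataset p x)
  (w : R -> R) (pi : Omega -> R)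
  (hw_concave : strictly_concave w)
  (hw_incr : {homo w : s t / s <= t})
  (hpi : probability_vector pi)
  (hpi_full : full_support pi)
  (hw_rat : SEU_rationalization p x w pi)
  (hx : forall i, non_diversified (x i))
  (Ustar : set (R -> R))
  (hU : scalable_class Ustar) :
  exists2 u : R -> R, Ustar u & SEU_rationalization p x u pi.
Proof.
have [Uprop [v Uv [y y0 sub]] Uscale] := hU.
(* A triple consists of an observation, its demanded state and a competing state; finiteness gives
   one margin [e] for all of them. *)
pose P (j : 'I_k * Omega * Omega) := (0 < x j.1.1 j.1.2) && (j.2 != j.1.2).
have [|j /andP[xo0 so]|e e0 gap] := @uniform_strict_gap R _ P
    (fun j => pi j.2 * p j.1.1 j.1.2) (fun j => pi j.1.2 * p j.1.1 j.2).
- by move=> j _; rewrite mulr_gt0//; apply: (hD _).1.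
- have [o [xo x_off]] := hx j.1.1.
  have jo : j.1.2 = o.
    by apply/eqP; apply: contraTT xo0 => /x_off ->; rewrite ltxx.
  rewrite jo in so *.
  exact: (corner_price_ratio x_off (hD _).1 hpi_full xo hw_concave hw_incr
    (hw_rat _) so).
have [_ cv _] := Uprop v Uv.
have [d [t0 [d0 t0_gt0 lin]]] := convex_near_linear cv y0 sub e0.
have m0 i o : 0 <= dot (p i) (x i) / p i o.
  rewrite divr_ge0 ?(ltW ((hD i).1 o))// sumr_ge0// => s _.
  by rewrite mulr_ge0 ?(ltW ((hD i).1 s))// (hD i).2.
(* A crude common bound on the quantity of any single good affordable in any observation; the added
   1 keeps it positive even without data. *)
pose T := 1 + \sum_i \sum_o dot (p i) (x i) / p i o.
have S0 : 0 <= \sum_i \sum_o dot (p i) (x i) / p i o.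
  by apply: sumr_ge0 => i _; apply: sumr_ge0.
have T0 : 0 < T by rewrite ltr_pwDl.
have leT i o : dot (p i) (x i) / p i o <= T.
  rewrite /T (bigD1 i)//= (bigD1 o)//= -!addrA [leRHS]addrCA lerDl.
  rewrite addr_ge0// addr_ge0// sumr_ge0// => j _.
  by apply: sumr_ge0.
(* Scaling by [al] sends [[0, T]] into [[0, t0]], where [v] is nearly linear; the cap at 1 is what
   scalability demands. *)
pose al := Order.min 1 (t0 / T).
have al0 : 0 < al by rewrite lt_min ltr01 divr_gt0.
have al1 : al <= 1 by rewrite ge_min lexx.
have alT : al * T <= t0 by rewrite -ler_pdivlMr// ge_min lexx orbT.
have [u Uu uE] := Uscale al v al0 al1 Uv; exists u => // i.
have [o [xo0 x_off]] := hx i.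
have [_ cu _] := Uprop u Uu.
apply: (@corner_SEU_max _ _ _ _ _ o x_off u (d * al) e T) => //.
- exact: (hD i).1.
- exact: mulr_gt0.
- move=> t t_ge0 tT; rewrite !uE// mulr0.
  have at0 : 0 <= al * t by rewrite mulr_ge0// ltW.
  have att0 : al * t <= t0 by apply: le_trans alT; rewrite ler_pM2l.
  by have := lin _ at0 att0; rewrite !mulrA.
- by move=> s so; apply: (gap (i, o, s)); rewrite /P/= xo0.
Qed.
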